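(* Let $n,m\geq 1$, let $(a^{ij}(x))$ be a symmetric positive definite $n\times n$ matrix at each $x\in\mathbb{R}^n$, and let $u=(u^1,\dots,u^m):\mathbb{R}^n\to\mathbb{R}^m$ be a smooth solution on $\mathbb{R}^n$ of the linear elliptic system $$\sum_{i,j=1}^n a^{ij}u^{\alpha}_{ij}=-u^{\alpha}+x\cdot Du^{\alpha},\qquad \alpha=1,\dots,m.$$ Assume that there is a constant $\sigma>0$ such that $$\sum_{i,j=1}^n a^{ij}(x)\xi_i\xi_j\leq\sigma|\xi|^2\quad\text{for all }x,\xi\in\mathbb{R}^n,$$ and that there are positive constants $r_0,c,\tau$ such that $$\sum_{i,j=1}^n\sum_{\alpha=1}^m a^{ij}(x)u^\alpha_i(x)u^\alpha_j(x)\leq c|x|^{2\tau-2}\quad\text{for all }|x|\geq r_0.$$ Then $|u|$ has polynomial growth. Namely, let $s_0$ be the unique number $s_0>1$ with $\frac{1}{s_0+1}\left(\frac{2s_0}{s_0+1}\right)^{s_0}=1$. For every $s\geq s_0$, setting $$k=\sqrt{\frac{2s}{s+1}},\qquad R_0^2=\max\left\{r_0^2,\ \frac{n\sigma+1}{2}\cdot\frac{k^2}{k^2-1}\right\},$$ there is a constant $C$ depending only on $\sigma,c,n,s,\tau,r_0$ such that for all $x\in\mathbb{R}^n$ and all $\alpha\in\{1,\dots,m\}$, $$u^{\alpha}(x)\leq C\left(1+\sup_{B_{\sqrt{k^2+1}\,R_0}}|u|\right)\left(1+|x|^{\max\{s,\tau\}}\right).$$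
   Context: Notation: $u^\alpha_i=\partial u^\alpha/\partial x_i$, $u^\alpha_{ij}=\partial^2u^\alpha/\partial x_i\partial x_j$, $Du^\alpha=(u^\alpha_1,\dots,u^\alpha_n)$, $\cdot$ is the standard inner product on $\mathbb{R}^n$, $|u|^2=\sum_\alpha (u^\alpha)^2$, and $B_R$ is the open ball in $\mathbb{R}^n$ of radius $R$ centred at the origin. *)

(* Defs.v *)
From mathcomp Require Import all_boot all_order all_algebra.
From mathcomp Require Import all_classical all_reals all_analysis.
Set Implicit Arguments.
Unset Strict Implicit.
Unset Printing Implicit Defensive.
Import Order.TTheory GRing.Theory Num.Theory.
Import numFieldNormedType.Exports.
Local Open Scope classical_set_scope.
Local Open Scope ring_scope.

Section Euclidean.
Context {R : realType} {n : nat}.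
Implicit Types x y : 'rV[R]_n.

Definition dot x y : R := \sum_(i < n) x 0 i * y 0 i.

(* The library norm `|x| on 'rV[R]_n is the sup norm, not the Euclidean one,
   so balls have to be redefined as well. *)
Definition enorm x : R := Num.sqrt (dot x x).

Definition eball (r : R) : set 'rV[R]_n := [set x | enorm x < r].

Definition posdefmx (A : 'M[R]_n) : Prop :=
  A^T = A /\
  forall xi : 'rV[R]_n, xi != 0 ->
    0 < \sum_(i < n) \sum_(j < n) A i j * xi 0 i * xi 0 j.

Definition partial (i : 'I_n) (f : 'rV[R]_n -> R) : 'rV[R]_n -> R :=
  fun x => 'D_(delta_mx 0 i) f x.

Definition grad (f : 'rV[R]_n -> R) (x : 'rV[R]_n) : 'rV[R]_n :=
  \row_(i < n) partial i f x.

(* C^oo: all iterated partial derivatives exist everywhere and are continuous.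
   The existence clause is needed because 'D_v is a total operator. *)
Definition smooth (f : 'rV[R]_n -> R) : Prop :=
  forall l : seq 'I_n,
    continuous (foldr partial f l) /\
    forall (i : 'I_n) (x : 'rV[R]_n),
      derivable (foldr partial f l) x (delta_mx 0 i).

End Euclidean.

Definition component {R : realType} {n m : nat} (u : 'rV[R]_n -> 'rV[R]_m)
    (alpha : 'I_m) : 'rV[R]_n -> R :=
  fun x => u x 0 alpha.

Definition critical_exponent {R : realType} (s : R) : Prop :=
  1 < s /\ (s + 1)^-1 * (2 * s / (s + 1)) `^ s = 1.

(* Main.v *)
Require Import Defs.
From mathcomp Require Import all_boot all_order all_algebra.
From mathcomp Require Import all_classical all_reals all_analysis.
From mathcomp Require Import ring lra.
Import Order.TTheory GRing.Theory Num.Theory.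
Import numFieldNormedType.Exports.
Local Open Scope classical_set_scope.
Local Open Scope ring_scope.

(** Write [w = |u|^2], [W = 1 + w], [q = |x|^2], [p = max s tau].  The growth
    bound is a maximum principle for the barrier [delta q^(-p) - 1/W]: passing to
    [1/W] makes the unknown bounded, so that no growth assumption at infinity is
    needed, and a positive value of the barrier outside [B_R0] forces a positive
    maximum [y] there.  At [y] the first order condition gives
    [y . Dw = 2 p Z] with [Z = delta W^2 q^(-p) > W], and contracting the second
    order condition with [a^ij] gives, by the system,
    [p (1 - n sigma / q) Z <= w + 3 E], where [E = a^ij u_i . u_j].  Since
    [q >= R0^2] the factor on the left is at least [1 + eta] with
    [eta = (s - 1) / (n sigma + 1)], hence
    [eta q^p / delta < eta W < 3 E <= 3 c q^(tau - 1) <= 3 c q^p],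
    which fails as soon as [3 c delta <= eta]. *)

(** * Directional derivatives of smooth functions *)

(** This reduction to one real variable lets the chain rule and the mean value theorem on the line
    serve for directional derivatives. *)
Lemma is_derive_lineP {R : realType} {V W : normedModType R} (f : V -> W)
    (x v : V) (df : W) :
  is_derive (0 : R) 1 (fun t : R => f (t *: v + x)) df <-> is_derive x v f df.
Proof.
have E : 'D_v f x = 'D_1 (fun t : R => f (t *: v + x)) 0.
  rewrite /derive; set g1 := fun h => _; set g2 := fun h => _.
  suff -> : g1 = g2 by [].
  by apply/funext => h; rewrite /g1 /g2 /= addr0 scale0r add0r [_%:A]mulr1.
split=> -[d e]; constructor; rewrite ?E -?e //.
- exact/derivable1P.
- exact: (derivable1P f x v).1.
Qed.

Lemma is_derive_line {R : realType} {V W : normedModType R} (f : V -> W)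
    (x v : V) (t : R) (df : W) :
  is_derive (t *: v + x) v f df ->
  is_derive t 1 (fun t : R => f (t *: v + x)) df.
Proof.
move=> /is_derive_lineP h; apply/is_derive_lineP.
suff E : (fun s : R => f (s *: v + (t *: v + x))) =
  (fun s : R => f ((s *: (1 : R^o) + t) *: v + x)) by rewrite E in h.
by apply/funext => s; rewrite addrA -scalerDl [_ *: 1]mulr1.
Qed.

Lemma is_derive_scalev {R : realType} {V : normedModType R} (f : V -> R)
    (x v : V) (k df : R) :
  is_derive x v f df -> is_derive x (k *: v) f (k * df).
Proof.
move=> /is_derive_lineP h; apply/is_derive_lineP.
have -> : (fun t : R => f (t *: (k *: v) + x)) =
  (fun t : R => f (t *: v + x)) \o (fun t : R => t * k).
  by apply/funext => t /=; rewrite scalerA.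
rewrite mulrC; apply: is_derive1_comp; first by rewrite mul0r.
suff -> : (fun t : R => t * k) = k *: (id : R -> R).
  by apply: is_derive_eq; rewrite [_%:A]mulr1.
by apply/funext => t /=; rewrite mulrC.
Qed.

(** Move from [x] first by [h *: w], then by [h *: v]. The mean value theorem writes the second
    increment as [h] times [dv] at a point tending to [x] with [h], and continuity of [dv] at [x]
    gives the limit. *)
Lemma is_derive_addv {R : realType} {V : normedModType R} (f dv : V -> R)
    (x v w : V) (dw : R) :
  (forall y, is_derive y v f (dv y)) -> {for x, continuous dv} ->
  is_derive x w f dw -> is_derive x (v + w) f (dv x + dw).
Proof.
move=> fv cdv fw.
have mvt (h : R) : exists s : R, `|s| <= 1 /\
    f (h *: (v + w) + x) - f (h *: w + x) = h * dv ((s * h) *: v + (h *: w + x)).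
  have Dphi (t : R) : is_derive t 1
      (fun t : R => f (t *: (h *: v) + (h *: w + x)))
      (h * dv (t *: (h *: v) + (h *: w + x))).
    by apply: is_derive_line; apply: is_derive_scalev; exact: fv.
  have [s|s] := @MVT_segment R _ _ 0 1 ler01 (fun t _ => Dphi t).
    apply: derivable_within_continuous => t _; exact: ex_derive.
  rewrite in_itv /= => /andP[s0 s1]; rewrite scale1r scale0r add0r subr0 mulr1.
  rewrite scalerA addrA -scalerDr => E.
  by exists s; split => //; rewrite ger0_norm.
have [S HS] := choice mvt.
have lim : h^-1 *: ((f \o shift x) (h *: (v + w)) - f x) @[h --> (0:R)^'] -->
    dv x + dw.
  have c1 : dv ((S h * h) *: v + (h *: w + x)) @[h --> (0:R)^'] --> dv x.
    have id0 : (fun h : R => h) @ (0:R)^' --> (0:R) by exact: cvg_within.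
    have Sh0 : S h * h @[h --> (0:R)^'] --> (0:R).
      apply/norm_cvg0P.
      have n0 : `|h| @[h --> (0:R)^'] --> (0:R) by apply/norm_cvg0P.
      apply: (squeeze_cvgr _ (cvg_cst 0) n0).
      near=> h; rewrite /= normr_ge0 normrM ler_piMl//.
      by case: (HS h).
    have : (S h * h) *: v + (h *: w + x) @[h --> (0:R)^'] -->
        0 *: v + (0 *: w + x).
      apply: cvgD; first exact: cvgZr_tmp.
      by apply: cvgD; [exact: cvgZr_tmp|exact: cvg_cst].
    rewrite !scale0r !add0r => Q; exact: cvg_comp Q cdv.
  have c2 : h^-1 *: ((f \o shift x) (h *: w) - f x) @[h --> (0:R)^'] --> dw.
    by case: fw => d <-.
  apply: cvg_trans (cvgD c1 c2); apply: near_eq_cvg; near=> h => /=.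
  have h0 : h != 0 by near: h; exact: nbhs_dnbhs_neq.
  have [_ E] := HS h.
  rewrite -[f (h *: (v + w) + x)](subrK (f (h *: w + x))) E -addrA scalerDr.
  by congr (_ + _); apply/esym/mulKf.
constructor; first by apply/cvg_ex; exists (dv x + dw).
exact/cvg_lim.
Unshelve. all: by end_near. Qed.

Lemma smooth_partial {R : realType} {n : nat} (f : 'rV[R]_n -> R) (i : 'I_n) :
  smooth f -> smooth (partial i f).
Proof. by move=> sf l; have := sf (rcons l i); rewrite foldr_rcons. Qed.

(** Since the partial derivatives are continuous, [v] can be assembled one coordinate at a time by
    [is_derive_addv]. *)
Lemma smooth_is_derive {R : realType} {n : nat} (f : 'rV[R]_n -> R)
    (x v : 'rV[R]_n) : smooth f ->
  is_derive x v f (\sum_(i < n) v 0 i * partial i f x).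
Proof.
move=> sf; rewrite [v in is_derive _ v]row_sum_delta.
elim: (index_enum _) => [|i l IHl].
  by rewrite !big_nil; exact: is_derive0.
rewrite !big_cons.
apply: (is_derive_addv _ (fun y => v 0 i * partial i f y)) => //.
- move=> y; apply: is_derive_scalev; apply: derivableP.
  by case: (sf [::]) => _ d; exact: (d i y).
- apply: (@continuousM _ _ (cst (v 0 i))); first exact: cst_continuous.
  by case: (sf [:: i]) => cf _; exact: cf.
Qed.

Lemma smooth_is_derive_line {R : realType} {n : nat} (f : 'rV[R]_n -> R)
    (x v : 'rV[R]_n) (t : R) : smooth f ->
  is_derive t 1 (fun t : R => f (t *: v + x))
    (\sum_(i < n) v 0 i * partial i f (t *: v + x)).
Proof. by move=> sf; apply: is_derive_line; exact: smooth_is_derive. Qed.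

Lemma smooth_is_derive_line2 {R : realType} {n : nat} (f : 'rV[R]_n -> R)
    (x v : 'rV[R]_n) (t : R) : smooth f ->
  is_derive t 1 (fun t : R => \sum_(i < n) v 0 i * partial i f (t *: v + x))
    (\sum_(i < n) \sum_(j < n)
       v 0 i * v 0 j * partial i (partial j f) (t *: v + x)).
Proof.
move=> sf; rewrite exchange_big/=.
have -> : (fun t : R => \sum_(i < n) v 0 i * partial i f (t *: v + x)) =
    \sum_(i < n) (v 0 i *: (fun t : R => partial i f (t *: v + x))).
  by apply/funext => s; rewrite fct_sumE.
apply: is_derive_sum => i; apply: is_derive_eq.
  by apply: is_deriveZ; apply: smooth_is_derive_line; exact: smooth_partial.
rewrite [_ *: _]mulr_sumr; apply: eq_bigr => j _.
by rewrite mulrA (mulrC (v 0 i)).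
Qed.

(** * Positive semidefinite matrices and their pairing *)

Section PositiveSemidefinite.
Context {R : realFieldType} {n : nat}.
Implicit Types (A H : 'M[R]_n) (x : 'rV[R]_n).

Let qform A x : R := \sum_(i < n) \sum_(j < n) A i j * x 0 i * x 0 j.

Lemma qformE A x : qform A x = (x *m A *m x^T) 0 0.
Proof.
rewrite mxE /qform exchange_big /=; apply: eq_bigr => j _.
rewrite !mxE mulr_suml; apply: eq_bigr => i _.
by rewrite (mulrC (A i j)).
Qed.

Lemma qform_deltaD A x t k : A^T = A ->
  qform A (x + t *: delta_mx 0 k) =
  qform A x + 2 * t * (\sum_(j < n) A k j * x 0 j) + t ^+ 2 * A k k.
Proof.
move=> symA; have rA : (delta_mx 0 k : 'rV_n) *m A = row k A by rewrite rowE.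
have e1 : ((delta_mx 0 k : 'rV_n) *m A *m x^T) 0 0 = \sum_(j < n) A k j * x 0 j.
  by rewrite rA mxE; apply: eq_bigr => j _; rewrite !mxE.
have e2 : (x *m A *m (delta_mx (0 : 'I_1) k)^T) 0 0 = \sum_(j < n) A k j * x 0 j.
  rewrite trmx_delta -colE !mxE; apply: eq_bigr => j _.
  by rewrite -[in RHS]symA mxE mulrC.
have e3 : ((delta_mx 0 k : 'rV_n) *m A *m (delta_mx (0 : 'I_1) k)^T) 0 0 = A k k.
  by rewrite rA trmx_delta -colE !mxE.
rewrite !qformE linearD /= linearZ /= !mulmxDl !mulmxDr -!scalemxAl -!scalemxAr.
have entryD (P Q : 'M[R]_1) : (P + Q) 0 0 = P 0 0 + Q 0 0 by rewrite mxE.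
have entryZ a (P : 'M[R]_1) : (a *: P) 0 0 = a * P 0 0 by rewrite mxE.
by rewrite !(entryD, entryZ) e1 e2 e3; ring.
Qed.

(** Once A_kk = 0, the form at e_j + t e_k is affine in t with slope 2 A_kj, so a nonzero A_kj would
    make it negative somewhere. *)
Lemma psd_diag0 A k : A^T = A -> (forall x, 0 <= qform A x) ->
  A k k = 0 -> forall j, A k j = 0.
Proof.
move=> symA psdA Akk j; apply/eqP/negPn/negP => Akj0.
(* The coefficient is chosen so that the form takes the value -1. *)
have := psdA (delta_mx 0 j + (- (A j j + 1) / (2 * A k j)) *: delta_mx 0 k).
rewrite qform_deltaD// Akk mulr0 addr0 qformE -rowE trmx_delta -colE !mxE.
rewrite (bigD1 j)//= !mxE !eqxx mulr1 big1 ?addr0; last first.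
  by move=> i /negPf ij; rewrite mxE ij andbF mulr0.
have -> : 2 * (- (A j j + 1) / (2 * A k j)) * A k j = - (A j j + 1) by field.
lra.
Qed.

(* Subtracting the rank-one matrix [A e_k (A e_k)^T / A_kk] clears row [k] and
   preserves semidefiniteness, so [A] is a sum of rank-one matrices. *)
Lemma psd_pairing_le0 A H : A^T = A -> (forall x, 0 <= qform A x) ->
  (forall x, qform H x <= 0) -> \sum_(i < n) \sum_(j < n) A i j * H i j <= 0.
Proof.
move=> symA psdA nH.
(* Induction on a list of indices outside which the rows of [A] vanish, starting from the full
   enumeration. *)
have : forall i j, i \notin enum 'I_n -> A i j = 0.
  by move=> i j; rewrite mem_enum.
elim: (enum 'I_n) A symA psdA => [|k l IHl] A symA psdA Al.
  by rewrite big1// => i _; rewrite big1// => j _; rewrite Al// mul0r.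
have [Akk|Akk] := eqVneq (A k k) 0.
  apply: IHl => // i j il; have [->|ik] := eqVneq i k; first exact: psd_diag0.
  by apply: Al; rewrite inE negb_or ik.
have symE i j : A i j = A j i by rewrite -[in LHS]symA mxE.
have Akk0 : 0 < A k k.
  rewrite lt_neqAle eq_sym Akk /=.
  by have := psdA (delta_mx 0 k); rewrite qformE -rowE trmx_delta -colE !mxE.
pose A' : 'M[R]_n := \matrix_(i, j) (A i j - A i k * A j k / A k k).
pose a : 'rV[R]_n := \row_i A i k.
have -> : \sum_(i < n) \sum_(j < n) A i j * H i j =
    \sum_(i < n) \sum_(j < n) A' i j * H i j + qform H a / A k k.
  rewrite /qform mulr_suml -big_split/=; apply: eq_bigr => i _.
  rewrite mulr_suml -big_split/=; apply: eq_bigr => j _.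
  by rewrite !mxE; field.
rewrite -[leRHS]addr0 lerD//; last by rewrite ler_pdivrMr// mul0r.
apply: IHl.
- by apply/matrixP => i j; rewrite !mxE (symE j i) (mulrC (A j k)).
(* Completing the square: the form of [A'] at [x] is that of [A] at x - (b / A_kk) e_k. *)
- move=> x; pose b := \sum_(j < n) A k j * x 0 j.
  have := psdA (x + (- (b / A k k)) *: delta_mx 0 k).
  rewrite qform_deltaD// -/b.
  suff -> : qform A' x = qform A x - b ^+ 2 / A k k.
    by congr (0 <= _); field.
  rewrite {1}/b expr2 {1}/qform mulr_suml mulr_suml -sumrB/=.
  apply: eq_bigr => i _; rewrite /b mulr_sumr mulr_suml -sumrB/=.
  by apply: eq_bigr => j _; rewrite !mxE (symE k i) (symE k j); field.
- move=> i j il; rewrite mxE; have [->|ik] := eqVneq i k.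
    by rewrite (symE j k); field.
  by rewrite (Al i j) ?(Al i k) ?mul0r ?subr0// inE negb_or ik.
Qed.

End PositiveSemidefinite.

(** * Extremum conditions in one variable, and the barrier along a line *)

(** If [g2 > 0], then [g1] is positive just to the right of 0 and the mean value theorem gives
    [g b > g 0] for a small [b]. The derivative is asked for only near 0 because the barrier is
    differentiated only where [Q > 0]. *)
Lemma second_derivative_test {R : realType} (g g1 : R -> R) (g2 : R) :
  (\forall t \near (0:R), is_derive (t:R) (1:R) g (g1 t)) ->
  is_derive (0:R) 1 g1 g2 ->
  (\forall t \near (0:R), g t <= g 0) -> g1 0 = 0 /\ g2 <= 0.
Proof.
move=> dg dg1 gmax.
have [e /= e0 He] := (nbhs_ballP _ _).1 (filterI dg gmax).
have in_e (t : R) : `|t| < e -> is_derive t 1 g (g1 t) /\ g t <= g 0.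
  by move=> te; apply: He; rewrite -ball_normE/= sub0r normrN.
have g10 : g1 0 = 0.
  have [||||_ g0] := @derive1_at_max R g (- e) e 0.
  - by rewrite ge0_cp// ltW.
  - move=> t; rewrite in_itv/= -ltr_norml => te.
    by have [d _] := in_e _ te; exact: ex_derive.
  - by rewrite in_itv/= oppr_lt0 e0.
  - by move=> t; rewrite in_itv/= -ltr_norml => te; have [] := in_e _ te.
  have [|[_ <-] _] := in_e 0; first by rewrite normr0.
  exact: g0.
split => //; rewrite leNgt; apply/negP => g20.
have lim : h^-1 *: ((g1 \o shift 0) (h *: (1 : R)) - g1 0)
    @[h --> (0:R)^'] --> g2.
  by case: dg1 => d <-.
have := cvgr_gt _ lim _ g20; rewrite near_withinE => near0.
have [d /= d0 Hd] := (nbhs_ballP _ _).1 (near0 _).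
pose b := Num.min d e / 2.
have b0 : 0 < b by rewrite divr_gt0// lt_min d0.
have [bd be] : b < d /\ b < e.
  by split; rewrite /b ltr_pdivrMr// mulr2n mulrDr mulr1 ltr_pwDl// ?lt_min ?d0//
    ge_min lexx ?orbT.
have [x||x] := @MVT R g g1 0 b b0.
- rewrite in_itv/= => /andP[x0 xb].
  by have [] := in_e x _; rewrite // gtr0_norm// (lt_trans xb).
- apply: derivable_within_continuous => x; rewrite in_itv/= => /andP[x0 xb].
  have [|/(@ex_derive _ _ _ _ _ _ _)] := in_e x _ => //.
  by rewrite ger0_norm// (le_lt_trans xb).
rewrite in_itv/= => /andP[x0 xb] E.
have g1x : 0 < g1 x.
  have := Hd x; rewrite -ball_normE/= sub0r normrN gtr0_norm//.
  move=> /(_ (lt_trans xb bd)).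
  rewrite gt_eqF// addr0 [_ *: 1]mulr1 g10 subr0 => /(_ isT).
  by rewrite pmulr_rgt0// invr_gt0.
have [|_] := in_e b; first by rewrite gtr0_norm.
by rewrite -subr_le0 E subr0 leNgt mulr_gt0.
Qed.

(** These are g' = 0 and g'' <= 0 at 0 for g = delta Q^(-p) - 1/W, multiplied by W^2 and W^3. The
    term p (p + 1) delta Q^(-p-2) Q1^2 of g'' is nonnegative and is dropped. *)
Lemma barrier_max {R : realType} (W W1 Q Q1 : R -> R) (W2 Q2 delta p : R) :
  0 < delta -> 0 < p ->
  (forall t : R, is_derive t 1 W (W1 t)) -> is_derive (0:R) 1 W1 W2 ->
  (forall t : R, is_derive t 1 Q (Q1 t)) -> is_derive (0:R) 1 Q1 Q2 ->
  (forall t, 0 < W t) -> 0 < Q 0 ->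
  (\forall t \near (0:R), delta * Q t `^ (- p) - (W t)^-1
                   <= delta * Q 0 `^ (- p) - (W 0)^-1) ->
  W1 0 = p * delta * W 0 ^+ 2 * Q 0 `^ (- p - 1) * Q1 0 /\
  W 0 * W2 - 2 * W1 0 ^+ 2
    <= p * delta * W 0 ^+ 3 * Q 0 `^ (- p - 1) * Q2.
Proof.
move=> delta0 p0 dW dW1 dQ dQ1 W0 Q0 fmax.
pose g t := delta * Q t `^ (- p) - (W t)^-1.
pose g1 t := - p * delta * (Q t `^ (- p - 1) * Q1 t) + (W t) ^- 2 * W1 t.
have Qnear : \forall t \near (0:R), 0 < Q t.
  have cQ : Q @ (0 : R) --> Q 0.
    apply: differentiable_continuous; apply/derivable1_diffP.
    by case: (dQ 0).
  exact: cvgr_gt cQ _ Q0.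
have dpow a (t : R) : 0 < Q t ->
    is_derive t 1 (powR (R:=R) ^~ a \o Q) (a * Q t `^ (a - 1) * Q1 t).
  by move=> Qt; apply: is_derive1_comp; exact: is_derive1_powR.
have Wn t : W t != 0 by rewrite gt_eqF.
have dg : \forall t \near (0:R), is_derive (t:R) (1:R) g (g1 t).
  apply: filterS Qnear => t Qt.
  have D : is_derive t 1
      (delta *: (powR (R:=R) ^~ (- p) \o Q) - (fun t => (W t)^-1))
      (delta *: (- p * Q t `^ (- p - 1) * Q1 t) - (- W t ^- 2 *: W1 t)).
    by apply: is_deriveB; apply: is_deriveZ; exact: dpow.
  apply: (is_derive_eq D); rewrite /g1 /GRing.scale/=; ring.
pose g2 := - p * delta * (Q 0 `^ (- p - 1) * Q2
    + (- p - 1) * Q 0 `^ (- p - 1 - 1) * Q1 0 ^+ 2)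
  + (W 0) ^- 2 * W2 - 2 * W 0 ^- 3 * W1 0 ^+ 2.
have dg1 : is_derive (0:R) 1 g1 g2.
  have D : is_derive (0:R) 1
      ((- p * delta) *: ((powR (R:=R) ^~ (- p - 1) \o Q) * Q1)
       + ((fun t => (W t)^-1) ^+ 2) * W1)
      ((- p * delta) *: ((powR (R:=R) ^~ (- p - 1) \o Q) 0 *: Q2
         + Q1 0 *: ((- p - 1) * Q 0 `^ (- p - 1 - 1) * Q1 0))
       + (((fun t => (W t)^-1) ^+ 2) 0 *: W2
         + W1 0 *: ((2%:R * (W 0)^-1 ^+ 1) *: (- W 0 ^- 2 *: W1 0)))).
    apply: is_deriveD.
      by apply: is_deriveZ; apply: is_deriveM; exact: dpow.
    apply: is_deriveM; apply: is_deriveX; exact: is_deriveV (Wn 0) (dW 0).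
  have -> : g1 = (- p * delta) *: ((powR (R:=R) ^~ (- p - 1) \o Q) * Q1)
       + ((fun t => (W t)^-1) ^+ 2) * W1.
    by apply/funext => t; rewrite /g1 -exprVn.
  apply: (is_derive_eq D).
  have -> : ((fun t => (W t)^-1) ^+ 2) 0 = W 0 ^- 2 by rewrite -exprVn.
  by rewrite /g2 /GRing.scale/=; field; exact: Wn.
have [g10 g20] := second_derivative_test g g1 g2 dg dg1 fmax.
have W10 : W1 0 = p * delta * W 0 ^+ 2 * Q 0 `^ (- p - 1) * Q1 0.
  suff -> : W1 0 = W 0 ^+ 2 * g1 0
      + p * delta * W 0 ^+ 2 * Q 0 `^ (- p - 1) * Q1 0.
    by rewrite g10 mulr0 add0r.
  by rewrite /g1; field; exact: Wn.
split => //.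
have : 0 <= p * delta * (p + 1) * Q 0 `^ (- p - 1 - 1) * Q1 0 ^+ 2.
  by rewrite mulr_ge0 ?sqr_ge0// mulr_ge0 ?powR_ge0// !mulr_ge0 ?addr_ge0 ?ltW.
set X := Q 0 `^ (- p - 1 - 1) => X0.
rewrite -subr_le0.
have -> : W 0 * W2 - 2 * W1 0 ^+ 2
    - p * delta * W 0 ^+ 3 * Q 0 `^ (- p - 1) * Q2 =
   W 0 ^+ 3 * (g2 - p * delta * (p + 1) * X * Q1 0 ^+ 2).
  rewrite /g2 -/X; field; exact: Wn.
rewrite pmulr_rle0 ?exprn_gt0//; lra.
Qed.

Lemma is_derive_sumM {R : realType} {m : nat} (f g : 'I_m -> R -> R)
    (df dg : 'I_m -> R) (t : R) :
  (forall i, is_derive t 1 (f i) (df i)) ->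
  (forall i, is_derive t 1 (g i) (dg i)) ->
  is_derive t 1 (fun t => \sum_(i < m) f i t * g i t)
    (\sum_(i < m) (f i t * dg i + g i t * df i)).
Proof.
move=> Df Dg.
have -> : (fun t => \sum_(i < m) f i t * g i t) = \sum_(i < m) (f i * g i).
  by apply/funext => s; rewrite fct_sumE.
by apply: is_derive_sum => i; exact: is_deriveM.
Qed.

(** Cauchy-Schwarz in the form suited to W = 1 + w. It comes from summing the squares of g_i (1 + F)
    - f_i s, with F the sum of f_i^2 and s that of f_i g_i. *)
Lemma sqr_sumM_le {R : realFieldType} {m : nat} (f g : 'I_m -> R) :
  (\sum_(i < m) f i * g i) ^+ 2 <=
  (1 + \sum_(i < m) f i ^+ 2) * \sum_(i < m) g i ^+ 2.
Proof.
have expand (S F : R) : \sum_(i < m) (g i * (1 + F) - f i * S) ^+ 2 =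
    (1 + F) ^+ 2 * (\sum_(i < m) g i ^+ 2)
    - 2 * (1 + F) * S * (\sum_(i < m) f i * g i) + S ^+ 2 * \sum_(i < m) f i ^+ 2.
  rewrite !mulr_sumr -sumrB -big_split/=.
  by apply: eq_bigr => i _; ring.
have := expand (\sum_(i < m) f i * g i) (\sum_(i < m) f i ^+ 2).
have : 0 <= \sum_(i < m) f i ^+ 2 by apply: sumr_ge0 => i _; exact: sqr_ge0.
set F := \sum_(i < m) f i ^+ 2; set s := \sum_(i < m) f i * g i.
set G := \sum_(i < m) g i ^+ 2 => F0 E.
have : 0 <= \sum_(i < m) (g i * (1 + F) - f i * s) ^+ 2.
  by apply: sumr_ge0 => i _; exact: sqr_ge0.
rewrite E.
have : 0 <= s ^+ 2 by exact: sqr_ge0.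
nra.
Qed.

(** * First and second order conditions at a maximum of the barrier *)

Section MaximumPoint.
Context {R : realType} {n m : nat}.
Variables (U : 'I_m -> 'rV[R]_n -> R) (y : 'rV[R]_n) (delta p : R).
Hypothesis smoothU : forall a, smooth (U a).
Hypotheses (delta0 : 0 < delta) (p0 : 0 < p) (y0 : 0 < dot y y).

Let W z : R := 1 + \sum_(a < m) U a z ^+ 2.
Let barrier z : R := delta * dot z z `^ (- p) - (W z)^-1.
Let B := p * delta * W y ^+ 2 * dot y y `^ (- p - 1).

Hypothesis ymax : \forall z \near y, barrier z <= barrier y.

Let D1 a (xi : 'rV[R]_n) := \sum_(i < n) xi 0 i * partial i (U a) y.
Let D2 a (xi : 'rV[R]_n) := \sum_(i < n) \sum_(j < n)
  xi 0 i * xi 0 j * partial i (partial j (U a)) y.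

(** [barrier_max] on the line through [y] in direction [xi]. With S, T, G the sums of U D1, U D2,
    D1^2, half of the second order condition reads W (T + G) - 4 S^2 <= W B |xi|^2, and S^2 <= W G
    bounds the left side below by W (T - 3 G); hence the factor 3. *)
Lemma line_max (xi : 'rV[R]_n) :
  \sum_(a < m) U a y * D1 a xi = B * dot xi y /\
  \sum_(a < m) U a y * D2 a xi - 3 * \sum_(a < m) D1 a xi ^+ 2 <= B * dot xi xi.
Proof.
have W0 z : 0 < W z by rewrite ltr_pwDl// sumr_ge0// => a _; exact: sqr_ge0.
pose z (t : R) := t *: xi + y.
pose phi1 a t := \sum_(i < n) xi 0 i * partial i (U a) (z t).
have z0 : z 0 = y by rewrite /z scale0r add0r.
have dphi a t : is_derive (t : R) 1 (U a \o z) (phi1 a t).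
  exact: smooth_is_derive_line.
have dphi1 a : is_derive (0 : R) 1 (phi1 a) (D2 a xi).
  by rewrite /D2 -z0; exact: smooth_is_derive_line2.
have dz i t : is_derive (t : R) 1 (fun t => z t 0 i) (xi 0 i).
  have -> : (fun t => z t 0 i) = xi 0 i *: (id : R -> R) + cst (y 0 i).
    by apply/funext => s; rewrite /z !mxE mulrC.
  apply: is_derive_eq; rewrite addr0; exact: mulr1.
pose W1 t := 2 * \sum_(a < m) U a (z t) * phi1 a t.
pose Q1 t := 2 * \sum_(i < n) xi 0 i * z t 0 i.
have dW t : is_derive (t : R) 1 (W \o z) (W1 t).
  have D := is_derive_sumM (fun a t => U a (z t)) (fun a t => U a (z t)) _ _ t
    (dphi ^~ t) (dphi ^~ t).
  have -> : W \o z = cst 1 + (fun t => \sum_(a < m) U a (z t) * U a (z t)).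
    by apply/funext => s; congr (1 + _); apply: eq_bigr => a _; rewrite expr2.
  apply: is_derive_eq; rewrite add0r /W1 mulr_sumr; apply: eq_bigr => a _.
  by ring.
have dW1 : is_derive (0 : R) 1 W1
    (2 * \sum_(a < m) (U a y * D2 a xi + D1 a xi ^+ 2)).
  have D := is_derive_sumM (fun a t => U a (z t)) phi1 _ _ 0 (dphi ^~ 0) dphi1.
  apply: (is_derive_eq (is_deriveZ 2 D)); rewrite [LHS]/GRing.scale/=.
  congr (2 * _); apply: eq_bigr => a _; rewrite /phi1 z0 -/(D1 a xi); ring.
have dQ t : is_derive (t : R) 1 (fun t => dot (z t) (z t)) (Q1 t).
  have D := is_derive_sumM (fun i t => z t 0 i) (fun i t => z t 0 i) _ _ t
    (dz ^~ t) (dz ^~ t).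
  apply: (is_derive_eq D); rewrite /Q1 mulr_sumr; apply: eq_bigr => i _.
  by ring.
have dQ1 : is_derive (0 : R) 1 Q1 (2 * dot xi xi).
  have D := is_derive_sumM (fun i t => xi 0 i) (fun i t => z t 0 i) _ _ 0
    (fun i => is_derive_cst (xi 0 i) (0 : R) (1 : R)) (dz ^~ 0).
  apply: (is_derive_eq (is_deriveZ 2 D)); rewrite [LHS]/GRing.scale/=.
  by congr (2 * _); apply: eq_bigr => i _; rewrite mulr0 addr0.
have [|||E1 E2] := barrier_max (W \o z) W1 (fun t => dot (z t) (z t)) Q1 _ _
    delta p delta0 p0 dW dW1 dQ dQ1.
- by move=> t; exact: W0.
- by rewrite z0.
- have cz : z t @[t --> (0 : R)] --> y.
    rewrite -[X in _ --> X]z0; apply: cvgD; last exact: cvg_cst.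
    by apply: cvgZr_tmp; exact: cvg_id.
  by have := cz _ ymax; rewrite /= z0.
have phi10 a : phi1 a 0 = D1 a xi by rewrite /phi1 z0.
have W10 : W1 0 = 2 * \sum_(a < m) U a y * D1 a xi.
  by rewrite /W1 z0; congr (2 * _); apply: eq_bigr => a _; rewrite phi10.
have Q10 : Q1 0 = 2 * dot xi y by rewrite /Q1 z0.
move: E1 E2; rewrite W10 Q10 /= z0.
set S := \sum_(a < m) U a y * D1 a xi => E1 E2; split.
  by move: E1; rewrite /B; lra.
have := sqr_sumM_le (fun a => U a y) (fun a => D1 a xi).
move: E2; rewrite big_split/= -/S -/(W y).
set T := \sum_(a < m) U a y * D2 a xi; set G := \sum_(a < m) D1 a xi ^+ 2.
move=> E2 CS; rewrite -(ler_pM2l (W0 y)).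
have -> : W y * (B * dot xi xi) =
    p * delta * W y ^+ 3 * dot y y `^ (- p - 1) * dot xi xi.
  by rewrite /B; ring.
nra.
Qed.

(** By the second order condition the matrix [H] below is negative semidefinite, so its pairing with
    [A] is nonpositive, and the system removes the second derivatives from that pairing. Here [tau]
    bounds the trace of [A]; it is not the growth exponent. *)
Lemma max_point_estimate (A : 'M[R]_n) (tau : R) : posdefmx A ->
  \sum_(i < n) A i i <= tau ->
  (forall a, \sum_(i < n) \sum_(j < n) A i j * partial i (partial j (U a)) y
     = - U a y + dot y (grad (U a) y)) ->
  B * (dot y y - tau) <= \sum_(a < m) U a y ^+ 2 +
    3 * \sum_(i < n) \sum_(j < n) \sum_(a < m)
          A i j * partial i (U a) y * partial j (U a) y.
Proof.
move=> [symA posA] trA pde.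
have B0 : 0 <= B.
  by rewrite /B mulr_ge0 ?powR_ge0// mulr_ge0 ?sqr_ge0// mulr_ge0 ?ltW.
pose H : 'M[R]_n := \matrix_(i, j)
  (\sum_(a < m) (U a y * partial i (partial j (U a)) y
     - 3 * (partial i (U a) y * partial j (U a) y)) - B * (i == j)%:R).
(* The coefficients stay arbitrary: [c] is [A] in the pairing and [xi 0 i * xi 0 j] in the quadratic
   form of [H]. *)
have HE (c : 'I_n -> 'I_n -> R) : \sum_(i < n) \sum_(j < n) c i j * H i j =
    \sum_(a < m) U a y *
      (\sum_(i < n) \sum_(j < n) c i j * partial i (partial j (U a)) y)
    - 3 * (\sum_(i < n) \sum_(j < n) \sum_(a < m)
             c i j * partial i (U a) y * partial j (U a) y)
    - B * \sum_(i < n) c i i.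
  have -> : \sum_(a < m) U a y *
      (\sum_(i < n) \sum_(j < n) c i j * partial i (partial j (U a)) y) =
      \sum_(i < n) \sum_(j < n) \sum_(a < m)
        c i j * (U a y * partial i (partial j (U a)) y).
    under eq_bigr do rewrite mulr_sumr.
    rewrite exchange_big/=; apply: eq_bigr => i _.
    under eq_bigr do rewrite mulr_sumr.
    rewrite exchange_big/=; apply: eq_bigr => j _.
    by apply: eq_bigr => a _; rewrite mulrCA.
  rewrite !mulr_sumr -!sumrB; apply: eq_bigr => i _.
  have -> : B * c i i = \sum_(j < n) c i j * (B * (i == j)%:R).
    rewrite (bigD1 i)//= eqxx mulr1 mulrC big1 ?addr0// => j /negPf.
    by rewrite eq_sym => ->; rewrite !mulr0.
  rewrite mulr_sumr -!sumrB; apply: eq_bigr => j _.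
  rewrite mxE mulrBr !mulr_sumr -sumrB; congr (_ - _).
  by apply: eq_bigr => a _; ring.
have psdA (x : 'rV[R]_n) : 0 <= \sum_(i < n) \sum_(j < n) A i j * x 0 i * x 0 j.
  have [->|x0] := eqVneq x 0; last by apply: ltW; exact: posA.
  by rewrite big1// => i _; rewrite big1// => j _; rewrite !mxE mulr0.
have := psd_pairing_le0 A H symA psdA.
rewrite HE; under [X in _ -> X - _ - _ <= _]eq_bigr do rewrite pde.
(* The first order condition in the direction [y] evaluates the drift term of the system. *)
have [E1 _] := line_max y.
have -> : \sum_(a < m) U a y * (- U a y + dot y (grad (U a) y)) =
  B * dot y y - \sum_(a < m) U a y ^+ 2.
  rewrite -E1 -sumrB; apply: eq_bigr => a _.
  have -> : dot y (grad (U a) y) = D1 a y.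
    by apply: eq_bigr => i _; rewrite mxE.
  by ring.
move=> AH; have := ler_wpM2l B0 trA; suff : forall xi : 'rV[R]_n,
    \sum_(i < n) \sum_(j < n) H i j * xi 0 i * xi 0 j <= 0 by move=> /AH; lra.
move=> xi; have [_] := line_max xi; rewrite -subr_le0.
have -> : \sum_(i < n) \sum_(j < n) H i j * xi 0 i * xi 0 j =
    \sum_(i < n) \sum_(j < n) (xi 0 i * xi 0 j) * H i j.
  by apply: eq_bigr => i _; apply: eq_bigr => j _; ring.
rewrite HE; apply: le_trans.
rewrite le_eqVlt; apply/orP; left; apply/eqP; congr (_ - 3 * _ - _).
have -> : \sum_(i < n) \sum_(j < n) \sum_(a < m)
      xi 0 i * xi 0 j * partial i (U a) y * partial j (U a) y =
    \sum_(i < n) \sum_(a < m) \sum_(j < n)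
      (xi 0 i * partial i (U a) y) * (xi 0 j * partial j (U a) y).
  apply: eq_bigr => i _; rewrite exchange_big/=; apply: eq_bigr => a _.
  by apply: eq_bigr => j _; ring.
rewrite exchange_big/=; apply: eq_bigr => a _.
by rewrite /D1 expr2 mulr_suml; apply: eq_bigr => i _; rewrite mulr_sumr.
Qed.

End MaximumPoint.

(** * The critical exponent *)

(** [G] is the logarithm of the defining expression, and [dG s], which is ln (2 s / (s + 1)), is
    also its derivative because s (1/s - 1/(s + 1)) - 1/(s + 1) = 0. It is positive for s > 1, so
    [G] increases strictly from - ln 2 at 1 and vanishes once, before 4. *)
Lemma critical_exponent_exists (R : realType) :
  exists s0 : R, unique critical_exponent s0.
Proof.
pose dG (s : R) := ln 2 + ln s - ln (s + 1).
pose G (s : R) := s * dG s - ln (s + 1).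
have critE (s : R) : 1 < s ->
    (s + 1)^-1 * (2 * s / (s + 1)) `^ s = expR (G s).
  move=> s1; have s0 : 0 < s by rewrite (lt_trans _ s1).
  have s10 : 0 < s + 1 by rewrite addr_gt0.
  rewrite /G expRB lnK ?posrE// mulrC; congr (_ / _).
  rewrite /powR gt_eqF ?divr_gt0 ?mulr_gt0//.
  by rewrite ln_div ?posrE ?mulr_gt0// lnM ?posrE.
have dGP (s : R) : 0 < s -> is_derive s 1 G (dG s).
  move=> s0; have s10 : 0 < s + 1 by rewrite addr_gt0.
  have D0 : is_derive s 1 (fun s : R => ln (s + 1)) (s + 1)^-1.
    rewrite -[(s + 1)^-1]mulr1.
    exact: (@is_derive1_comp R (@ln R) (shift 1) _ _ _ (is_derive1_ln s10)
      (is_derive_shift s 1 1)).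
  have Dln := is_derive1_ln s0.
  have D := is_deriveB (is_deriveM (is_derive_id s 1)
    (is_deriveB (is_deriveD (is_derive_cst (ln (2 : R)) s 1) Dln) D0)) D0.
  apply: (is_derive_eq D).
  transitivity (s * (0 + s^-1 - (s + 1)^-1) + dG s * 1 - (s + 1)^-1) => //.
  by field; rewrite !gt_eqF.
have dG0 (s : R) : 1 < s -> 0 < dG s.
  move=> s1; have s0 : 0 < s by rewrite (lt_trans _ s1).
  rewrite subr_gt0 -lnM ?posrE// ltr_ln ?posrE ?mulr_gt0 ?addr_gt0//; lra.
have Gcont (a b : R) : 0 < a -> {within `[a, b], continuous G}.
  move=> a0; apply: derivable_within_continuous => x.
  rewrite in_itv/= => /andP[ax _]; apply: ex_derive.
  by apply: dGP; rewrite (lt_le_trans a0).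
have Gincr (x y : R) : 1 <= x -> x < y -> G x < G y.
  move=> x1 xy; apply: (@gtr0_derive1_incr R G 1 y) => //.
  - move=> z; rewrite in_itv/= => /andP[z1 _]; apply: ex_derive.
    by apply: dGP; rewrite (lt_trans _ z1).
  - move=> z; rewrite in_itv/= => /andP[z1 _].
    rewrite derive1E; have [|_ ->] := dGP z; first by rewrite (lt_trans _ z1).
    exact: dG0.
  - exact: Gcont.
have G1 : G 1 < 0.
  rewrite /G /dG ln1 mul1r addr0 (_ : 1 + 1 = 2 :> R) ?subrr ?sub0r ?oppr_lt0//.
  by rewrite ln_gt0// ltr1n.
have G4 : 0 < G 4.
  rewrite -expR_gt1 -critE ?ltr1n// powR_mulrn; last first.
    by rewrite divr_ge0 ?mulr_ge0 ?addr_ge0.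
  suff -> : (4 + 1)^-1 * (2 * 4 / (4 + 1)) ^+ 4 = 4096 / 3125 :> R by lra.
  by field.
have [|||s0] := @IVT R G 1 4 0.
- by rewrite ler1n.
- exact: Gcont.
- by rewrite ge_min (ltW G1)/= le_max (ltW G4) orbT.
rewrite in_itv/= => /andP[s01 _] Gs0.
have s01' : 1 < s0.
  rewrite lt_neqAle s01 andbT; apply/eqP => s0E.
  by move: G1; rewrite s0E Gs0 ltxx.
exists s0; split; first by split => //; rewrite critE// Gs0 expR0.
move=> s [s1]; rewrite critE// => /eqP; rewrite -expR0 => /eqP/expR_inj Gs.
apply/eqP; case: ltgtP => // [ss0|ss0]; exfalso.
- by have := Gincr s0 s s01 ss0; rewrite Gs0 Gs ltxx.
- by have := Gincr s s0 (ltW s1) ss0; rewrite Gs0 Gs ltxx.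
Qed.

(** * Euclidean norm, continuity and compact shells *)

Lemma enorm_sqr {R : realType} {n : nat} (x : 'rV[R]_n) : enorm x ^+ 2 = dot x x.
Proof. by rewrite sqr_sqrtr// sumr_ge0// => i _; rewrite -expr2 sqr_ge0. Qed.

Lemma dot_ge0 {R : realType} {n : nat} (x : 'rV[R]_n) : 0 <= dot x x.
Proof. by rewrite -enorm_sqr sqr_ge0. Qed.

Lemma continuous_dot {R : realType} {n : nat} :
  continuous (fun x : 'rV[R]_n => dot x x).
Proof.
apply: continuous_big => [|i _]; first exact: add_continuous.
by move=> x; apply: continuousM; exact: coord_continuous.
Qed.

Lemma compact_dot_itv {R : realType} {n : nat} (a b : R) :
  compact [set x : 'rV[R]_n | a <= dot x x <= b].
Proof.
(* The bound [b + 1] avoids a square root: x_i^2 <= b implies |x_i| <= b + 1. *)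
pose box := [set x : 'rV[R]_n | forall i, `[- (b + 1), b + 1]%classic (x 0 i)].
apply: (@subclosed_compact _ _ box).
- have -> : [set x : 'rV[R]_n | a <= dot x x <= b] =
      (fun x => dot x x) @^-1` `[a, b]%classic.
    by apply/seteqP; split => x /=; rewrite in_itv.
  apply: preimage_closed; first by move=> x _; exact: continuous_dot.
  exact: interval_closed.
- by apply: (@rV_compact _ _ (fun=> `[- (b + 1), b + 1]%classic)) => _;
    exact: segment_compact.
- move=> x /= /andP[_ xb] i; rewrite /= in_itv/=.
  have : x 0 i * x 0 i <= b.
    apply: le_trans xb; rewrite /dot (bigD1 i)//= lerDl sumr_ge0// => j _.
    by rewrite -expr2 sqr_ge0.
  nra.
Qed.

Lemma smooth_continuous {R : realType} {n : nat} (f : 'rV[R]_n -> R) :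
  smooth f -> continuous f.
Proof. by move=> sf; case: (sf [::]). Qed.

Lemma continuous_sumsqr {R : realType} {n m : nat}
    (U : 'I_m -> 'rV[R]_n -> R) : (forall a, continuous (U a)) ->
  continuous (fun z => \sum_(a < m) U a z ^+ 2).
Proof.
move=> cU; apply: continuous_big => [|a _]; first exact: add_continuous.
by move=> z; under eq_fun do rewrite expr2; apply: continuousM; exact: cU.
Qed.

(** * The maximum principle for the barrier *)

(** The conclusion is [f <= 0] for the barrier [f], cleared of denominators. A positive value [f x1]
    produces an interior maximum over a shell rho <= q <= L, where [max_point_estimate] contradicts
    the energy bound. *)
Lemma barrier_le {R : realType} {n m : nat} (U : 'I_m -> 'rV[R]_n -> R)
    (A : 'rV[R]_n -> 'M[R]_n) (T c tau p rho eta delta : R) :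
  (forall a, smooth (U a)) -> (forall x, posdefmx (A x)) ->
  (forall x, \sum_(i < n) A x i i <= T) ->
  (forall x a,
     \sum_(i < n) \sum_(j < n) A x i j * partial i (partial j (U a)) x
     = - U a x + dot x (grad (U a) x)) ->
  (forall x, rho <= dot x x ->
     \sum_(i < n) \sum_(j < n) \sum_(a < m)
       A x i j * partial i (U a) x * partial j (U a) x
     <= c * dot x x `^ (tau - 1)) ->
  0 < c -> 0 < p -> tau <= p -> 0 < eta -> 0 < delta -> 3 * c * delta <= eta ->
  1 <= rho ->
  (forall q, rho <= q -> (1 + eta) * q <= p * (q - T)) ->
  (forall x, dot x x = rho ->
     delta * (1 + \sum_(a < m) U a x ^+ 2) <= rho `^ p) ->
  forall x, rho <= dot x x ->
    delta * (1 + \sum_(a < m) U a x ^+ 2) <= dot x x `^ p.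
Proof.
move=> sU posA trA pde energy c0 p0 taup eta0 delta0 deltaE rho1 rhoT bdry.
move=> x1 x1rho.
pose q (x : 'rV[R]_n) := dot x x.
pose W (x : 'rV[R]_n) := 1 + \sum_(a < m) U a x ^+ 2.
pose f x := delta * q x `^ (- p) - (W x)^-1.
have W0 x : 0 < W x by rewrite ltr_pwDl// sumr_ge0// => a _; exact: sqr_ge0.
have fE x : 0 < q x -> (f x <= 0) = (delta * W x <= q x `^ p).
  move=> qx; rewrite /f subr_le0 powRN -ler_pdivlMr ?invr_gt0 ?powR_gt0// invrK.
  by rewrite -ler_pdivlMr// mulrC.
have rho0 : 0 < rho by rewrite (lt_le_trans _ rho1).
have q0 x : rho <= q x -> 0 < q x by apply: lt_le_trans.
rewrite -/(q x1) -/(W x1) -fE; last exact: q0.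
rewrite leNgt; apply/negP => f1.
(* For q >= L the term delta q^(-p) is at most f(x1) / 2, so [f] stays below [f x1] and the maximum
   avoids the outer sphere. *)
pose L := (2 * delta / f x1) `^ p^-1.
have L0 : 0 < L by rewrite powR_gt0// !(mulr_gt0, invr_gt0).
have fL x : L <= q x -> f x < f x1.
  move=> Lq; have : L `^ p <= q x `^ p.
    by apply: ge0_ler_powR; rewrite ?nnegrE ?dot_ge0 // ltW.
  rewrite /L -powRrM mulVf ?gt_eqF// powRr1; last first.
    by rewrite ltW// !(mulr_gt0, invr_gt0).
  have qp0 : 0 < q x `^ p by rewrite powR_gt0// (lt_le_trans L0).
  rewrite ler_pdivrMr// => Lq'.
  have : delta * q x `^ (- p) < f x1.
    rewrite powRN ltr_pdivrMr//; nra.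
  by apply: le_lt_trans; rewrite /f lerBlDr lerDl invr_ge0 ltW.
have cf x : 0 < q x -> {for x, continuous f}.
  move=> qx.
  have cpow : {for x, continuous (fun x => q x `^ (- p))}.
    apply: (@continuous_comp _ _ _ q (powR (R:=R) ^~ (- p))).
      exact: continuous_dot.
    apply: differentiable_continuous; apply/derivable1_diffP.
    by have [] := is_derive1_powR (- p) qx.
  have cW : {for x, continuous W}.
    apply: (@continuousD R R^o 'rV[R]_n (cst 1)
      (fun x => \sum_(a < m) U a x ^+ 2)).
      exact: cst_continuous.
    by apply: continuous_sumsqr => a; exact: smooth_continuous.
  apply: (@continuousB R R^o 'rV[R]_n (fun x => delta * q x `^ (- p))).
    by apply: (@continuousM _ _ (cst delta)); [exact: cst_continuous|].
  by apply: continuousV; rewrite ?gt_eqF.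
pose K := [set x | rho <= q x <= L].
have [||y /[!inE] /andP[rhoy yL] ymax] :=
  EVT_max_rV (A := K) (f := f) _ (compact_dot_itv rho L).
- exists x1; rewrite /K /= x1rho leNgt/=; apply/negP => /ltW/fL.
  by rewrite ltxx.
- by apply: continuous_in_subspaceT => x /[!inE] /andP[+ _] => /q0/cf.
have fy : f x1 <= f y.
  apply: ymax; rewrite inE /K/= x1rho leNgt/=; apply/negP => /ltW/fL.
  by rewrite ltxx.
have fy0 : 0 < f y by exact: lt_le_trans fy.
have {}yL : q y < L.
  by rewrite ltNge; apply/negP => /fL; rewrite ltNge fy.
(* On the inner sphere [bdry] gives f <= 0, while f(y) > 0. *)
have {}rhoy : rho < q y.
  rewrite lt_neqAle rhoy andbT; apply/eqP => rhoE.
  move: fy0; rewrite ltNge fE -?rhoE// => /negP; apply.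
  by apply: bdry; rewrite rhoE.
have qy := q0 _ (ltW rhoy).
have ynear : \forall z \near y, f z <= f y.
  have n1 := cvgr_gt _ (continuous_dot y) _ rhoy.
  have n2 := cvgr_lt _ (continuous_dot y) _ yL.
  near=> z; apply: ymax; rewrite inE /K/=; apply/andP; split; apply: ltW.
    by near: z; exact: n1.
  by near: z; exact: n2.
have := max_point_estimate U y delta p sU delta0 p0 qy ynear (A y) T (posA y)
  (trA y) (pde y).
rewrite -/(W y) -/(q y).
have := energy y (ltW rhoy); rewrite -/(q y).
set E := \sum_(i < n) _ => Ey.
set w := \sum_(a < m) _.
have wW : w = W y - 1 by rewrite /W addrC addKr.
rewrite wW => est.
pose Z := delta * W y ^+ 2 * q y `^ (- p).
have qp0 := powR_gt0 p qy.
have ZE : p * delta * W y ^+ 2 * q y `^ (- p - 1) * (q y - T)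
    = (Z / q y) * (p * (q y - T)).
  have -> : q y `^ (- p - 1) = q y `^ (- p) / q y.
    by rewrite powRB ?(gt_eqF qy) ?implybT// powRr1// ltW.
  rewrite /Z; field.
  by rewrite gt_eqF.
(* By [rhoT] the factor p (q - T) / q is at least 1 + eta. *)
have Zge : (1 + eta) * Z <= W y - 1 + 3 * E.
  apply: le_trans est; rewrite ZE.
  have -> : (1 + eta) * Z = Z / q y * ((1 + eta) * q y) by field; rewrite gt_eqF.
  apply: ler_wpM2l; last exact/rhoT/ltW.
  by rewrite divr_ge0 ?(ltW qy)// mulr_ge0 ?powR_ge0// mulr_ge0 ?sqr_ge0// ltW.
have Wy : q y `^ p < delta * W y by move: fy0; rewrite !ltNge fE.
have ZW : W y < Z.
  rewrite /Z powRN ltr_pdivlMr//.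
  rewrite (_ : delta * _ = W y * (delta * W y)); last by ring.
  by rewrite ltr_pM2l.
have qtau : q y `^ (tau - 1) <= q y `^ p.
  rewrite ler_powR// ?(le_trans rho1) ?ltW//; lra.
have Ep : E <= c * q y `^ p by apply: le_trans Ey _; rewrite ler_pM2l.
(* As W < Z, [Zge] leaves eta W < 3 E. Multiplied by delta, this is incompatible with q^p < delta
   W. *)
have : eta * W y < 3 * c * q y `^ p by nra.
have : eta * q y `^ p < eta * (delta * W y) by rewrite ltr_pM2l.
have : 3 * c * delta * q y `^ p <= eta * q y `^ p by rewrite ler_pM2r.
nra.
Unshelve. all: by end_near. Qed.

(** * The growth bound *)

Lemma quadratic_form_delta {R : realType} {n : nat} (A : 'M[R]_n) (k : 'I_n) :
  \sum_(i < n) \sum_(j < n)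
    A i j * (delta_mx 0 k : 'rV[R]_n) 0 i * (delta_mx 0 k : 'rV[R]_n) 0 j = A k k.
Proof. by rewrite qformE -rowE trmx_delta -colE !mxE. Qed.

(** This makes [sup] over the ball a genuine upper bound; the maximum over the compact closed ball
    supplies it. *)
Lemma has_ubound_enorm {R : realType} {n m : nat} (u : 'rV[R]_n -> 'rV[R]_m)
    (r : R) : (forall a, continuous (component u a)) ->
  has_ubound [set enorm (u y) | y in eball r].
Proof.
move=> cu; have [r0|r0] := ltP 0 r; last first.
  exists 0 => _ [y /= yr <-]; exfalso; have := sqrtr_ge0 (dot y y).
  by rewrite -/(enorm y) leNgt (lt_le_trans yr).
have [||y _ ymax] :=
  EVT_max_rV (A := [set x : 'rV[R]_n | 0 <= dot x x <= r ^+ 2])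
  (f := fun z => \sum_(a < m) component u a z ^+ 2) _
    (compact_dot_itv 0 (r ^+ 2)).
- exists 0; rewrite /= /dot big1 ?lexx ?sqr_ge0// => i _.
  by rewrite mxE mul0r.
- by apply: continuous_subspaceT; exact: continuous_sumsqr.
exists (enorm (u y)) => _ [z /= zr <-].
have enormE x : enorm (u x) = Num.sqrt (\sum_(a < m) component u a x ^+ 2).
  by congr Num.sqrt; apply: eq_bigr => a _; rewrite expr2.
rewrite !enormE ler_wsqrtr//; apply: ymax; rewrite inE/= dot_ge0/= -enorm_sqr.
by rewrite ler_sqr ?nnegrE ?sqrtr_ge0 ?ltW.
Qed.

Theorem theorem18 (R : realType) :
  exists s0 : R, unique critical_exponent s0 /\
  forall (n : nat) (sigma c tau r0 s : R),
    (1 <= n)%N -> 0 < sigma -> 0 < c -> 0 < tau -> 0 < r0 -> s0 <= s ->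
  let k := Num.sqrt (2 * s / (s + 1)) in
  let R0 := Num.sqrt (Num.max (r0 ^+ 2)
              ((n%:R * sigma + 1) / 2 * (k ^+ 2 / (k ^+ 2 - 1)))) in
  exists C : R,
  forall (m : nat) (a : 'rV[R]_n -> 'M[R]_n) (u : 'rV[R]_n -> 'rV[R]_m),
    (1 <= m)%N ->
    (forall x, posdefmx (a x)) ->
    (forall alpha, smooth (component u alpha)) ->
    (forall x alpha,
       \sum_(i < n) \sum_(j < n)
          a x i j * partial i (partial j (component u alpha)) x
       = - component u alpha x + dot x (grad (component u alpha) x)) ->
    (forall x xi : 'rV[R]_n,
       \sum_(i < n) \sum_(j < n) a x i j * xi 0 i * xi 0 j
       <= sigma * enorm xi ^+ 2) ->
    (forall x, r0 <= enorm x ->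
       \sum_(i < n) \sum_(j < n) \sum_(alpha < m)
          a x i j * partial i (component u alpha) x
                  * partial j (component u alpha) x
       <= c * enorm x `^ (2 * tau - 2)) ->
  forall (x : 'rV[R]_n) (alpha : 'I_m),
    component u alpha x <=
      C * (1 + sup [set enorm (u y) | y in eball (Num.sqrt (k ^+ 2 + 1) * R0)])
        * (1 + enorm x `^ (Num.max s tau)).
Proof.
have [s0 s0P] := critical_exponent_exists R; exists s0; split => //.
move=> n sigma c tau r0 s n1 sigma0 c0 tau0 r00 s0s k R0.
have s1 : 1 < s by apply: lt_le_trans s0s; case: s0P => -[].
have s1p : 0 < s + 1 by lra.
have sm : 0 < s - 1 by lra.
have k2 : k ^+ 2 = 2 * s / (s + 1) by rewrite sqr_sqrtr// divr_ge0//; lra.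
pose T := n%:R * sigma.
have T0 : 0 <= T by rewrite mulr_ge0 ?ler0n// ltW.
have T1 : 0 < T + 1 by lra.
pose rho := R0 ^+ 2.
(* Here k^2 / (k^2 - 1) = 2 s / (s - 1). *)
have rhoE : rho = Num.max (r0 ^+ 2) ((T + 1) * s / (s - 1)).
  rewrite /rho sqr_sqrtr; last by rewrite le_max sqr_ge0.
  congr Num.max; rewrite k2 /T; field.
  by rewrite !gt_eqF//; lra.
have r0rho : r0 ^+ 2 <= rho by rewrite rhoE le_max lexx.
have Trho : (T + 1) * s / (s - 1) <= rho by rewrite rhoE le_max lexx orbT.
have rho1 : 1 <= rho.
  apply: le_trans Trho; rewrite ler_pdivlMr//; nra.
have rho0 : 0 < rho by lra.
have R00 : 0 < R0.
  rewrite lt_neqAle sqrtr_ge0 andbT; apply/eqP => E.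
  by move: rho0; rewrite /rho -E expr0n ltxx.
pose p := Num.max s tau.
have sp : s <= p by rewrite le_max lexx.
have taup : tau <= p by rewrite le_max lexx orbT.
have p0 : 0 < p by lra.
(* This value gives (1 + eta) q = s (q - T) exactly at the threshold q = (T + 1) s / (s - 1), which
   [rho] dominates. *)
pose eta := (s - 1) / (T + 1).
have eta0 : 0 < eta by rewrite divr_gt0.
have rhoT q : rho <= q -> (1 + eta) * q <= p * (q - T).
  move=> qrho; have : (T + 1) * s / (s - 1) <= q by exact: le_trans qrho.
  rewrite ler_pdivrMr// => Tq.
  have qT : 0 <= q - T by nra.
  apply: le_trans (ler_wpM2r qT sp); rewrite -subr_ge0.
  have -> : s * (q - T) - (1 + eta) * q =
      T / (T + 1) * (q * (s - 1) - (T + 1) * s).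
    by rewrite /eta; field; rewrite gt_eqF.
  by rewrite mulr_ge0 ?subr_ge0// divr_ge0// ltW.
(* The first argument serves the condition 3 c delta <= eta, the second the condition on the sphere
   q = rho. *)
pose d0 := Num.min (eta / (3 * c)) (rho `^ p).
have d00 : 0 < d0 by rewrite lt_min powR_gt0// divr_gt0// mulr_gt0.
pose D := Num.sqrt d0^-1.
have D0 : 0 <= D by exact: sqrtr_ge0.
have D2 : D ^+ 2 = d0^-1 by rewrite sqr_sqrtr// invr_ge0 ltW.
(* [D] is d0^(-1/2) and serves outside the ball of radius [R0]; the summand 1 serves inside, where
   |u| <= S. The witness is fixed before [m], [a] and [u]. *)
exists (1 + D) => m a u m1 posA smu pde upA energy x alpha.
set S := sup _.
have sumE z : \sum_(b < m) component u b z ^+ 2 = enorm (u z) ^+ 2.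
  by rewrite enorm_sqr; apply: eq_bigr => b _; rewrite expr2.
(* As k^2 + 1 > 1, the closed ball of radius [R0] lies in the open ball that defines [S]. *)
have ubS z : dot z z <= rho -> enorm (u z) <= S.
  move=> zrho; apply: ub_le_sup.
    by apply: has_ubound_enorm => b; exact: smooth_continuous.
  exists z => //=; rewrite /eball/=.
  have zR0 : enorm z <= R0.
    by rewrite -ler_sqr ?nnegrE ?sqrtr_ge0// enorm_sqr.
  apply: le_lt_trans zR0 _; rewrite ltr_pMl// -{1}sqrtr1 ltr_sqrt.
    by rewrite ltrDr k2 divr_gt0//; lra.
  by rewrite k2 addr_gt0// divr_gt0//; lra.
have S0 : 0 <= S.
  apply: le_trans (ubS 0 _); first exact: sqrtr_ge0.
  by rewrite /dot big1 ?ltW// => i _; rewrite mxE mul0r.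
have trA z : \sum_(i < n) a z i i <= T.
  rewrite /T mulr_natl -[n in _ *+ n]card_ord -sumr_const; apply: ler_sum => i _.
  have := upA z (delta_mx 0 i); rewrite quadratic_form_delta enorm_sqr.
  rewrite /dot (bigD1 i)//= !mxE !eqxx mulr1 big1 ?addr0 ?mulr1// => j /negPf ji.
  by rewrite mxE ji andbF mul0r.
have energy' z : rho <= dot z z ->
     \sum_(i < n) \sum_(j < n) \sum_(b < m)
       a z i j * partial i (component u b) z * partial j (component u b) z
     <= c * dot z z `^ (tau - 1).
  move=> zrho; have -> : dot z z `^ (tau - 1) = enorm z `^ (2 * tau - 2).
    rewrite -enorm_sqr -powR_mulrn ?sqrtr_ge0// -powRrM; congr powR; ring.
  apply: energy; rewrite -ler_sqr ?nnegrE ?sqrtr_ge0 ?(ltW r00)// enorm_sqr.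
  exact: le_trans zrho.
have S2 : 0 < 1 + S ^+ 2 by rewrite ltr_pwDl// sqr_ge0.
(* The divisor absorbs 1 + |u|^2 on the sphere q = rho, where |u| <= S. *)
pose delta := d0 / (1 + S ^+ 2).
have delta0 : 0 < delta by rewrite divr_gt0.
have deltad0 : delta <= d0.
  by rewrite ler_pdivrMr// ler_peMr ?(ltW d00)// lerDl sqr_ge0.
have deltaE : 3 * c * delta <= eta.
  rewrite mulrC -ler_pdivlMr ?mulr_gt0//; apply: le_trans deltad0 _.
  by rewrite ge_min lexx.
have bdry z : dot z z = rho ->
    delta * (1 + \sum_(b < m) component u b z ^+ 2) <= rho `^ p.
  move=> zrho; have : enorm (u z) ^+ 2 <= S ^+ 2.
    by rewrite ler_sqr ?nnegrE ?sqrtr_ge0 ?ubS ?zrho.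
  rewrite sumE => uS; apply: (@le_trans _ _ d0); last by rewrite ge_min lexx orbT.
  by rewrite /delta mulrAC ler_pdivrMr// ler_pM2l// lerD2l.
have bound := barrier_le _ _ _ _ _ _ _ _ _ smu posA trA (fun z b => pde z b)
  energy' c0 p0 taup eta0 delta0 deltaE rho1 rhoT bdry.
have Np : 0 <= enorm x `^ p by exact: powR_ge0.
have ux : component u alpha x <= enorm (u x).
  apply: le_trans (ler_norm _) _; rewrite -ler_sqr ?nnegrE ?sqrtr_ge0//.
  rewrite -sumE real_normK ?num_real// (bigD1 alpha)//= lerDl sumr_ge0// => b _.
  exact: sqr_ge0.
apply: le_trans ux _; have [xrho|/ltW/bound] := leP (dot x x) rho.
  apply: le_trans (ubS x xrho) _; apply: (@le_trans _ _ ((1 + D) * (1 + S))).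
    nra.
  by rewrite ler_peMr ?lerDl// mulr_ge0 ?addr_ge0.
rewrite sumE /delta mulrAC ler_pdivrMr// => ux2.
have qp : dot x x `^ p = (enorm x `^ p) ^+ 2.
  by rewrite -enorm_sqr -!powR_mulrn ?powR_ge0 ?sqrtr_ge0// powRAC.
(* Squared, this is |u|^2 <= (1 + S^2) q^p / d0 together with 1 + S^2 <= (1 + S)^2. *)
apply: (@le_trans _ _ (D * (1 + S) * enorm x `^ p)).
  rewrite -ler_sqr ?nnegrE ?sqrtr_ge0 ?mulr_ge0 ?addr_ge0//.
  rewrite !exprMn D2 -qp -mulrA mulrC ler_pdivlMr// mulrC (mulrC (_ ^+ 2)).
  apply: (@le_trans _ _ (d0 * (1 + enorm (u x) ^+ 2))).
    by rewrite ler_pM2l// lerDr.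
  apply: le_trans ux2 _; rewrite ler_wpM2l ?powR_ge0//; nra.
have : 0 <= D * (1 + S) by rewrite mulr_ge0// addr_ge0.
nra.
Qed.
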